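(* For every Abelian group $G$ (written additively), there exists a colouring $c:G\longrightarrow C$, with $C$ a countably infinite set, such that for every infinite subset $X\subseteq G$ the set $X+X$ is not monochromatic (i.e. $c$ is not constant on $X+X$).
   Context: For a subset $X$ of an additively written Abelian group, $X+X=\{x+y \mid x,y\in X\}$; here $x=y$ is allowed, so $X+X$ contains all elements $2x$ with $x\in X$. A colouring $c:G\longrightarrow C$ is simply a function. *)

(* Defs.v *)
From HB Require Import structures.
From mathcomp Require Import all_boot all_order all_algebra.
From mathcomp Require Import boolp classical_sets functions cardinality.
Set Implicit Arguments.
Unset Strict Implicit.
Unset Printing Implicit Defensive.

Local Open Scope classical_set_scope.
Local Open Scope ring_scope.

(* The two summands range over X independently, so x + x is included. *)
Definition sumset (G : zmodType) (X : set G) : set G :=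
  [set x + y | x in X & y in X].

Definition monochromatic (G C : Type) (c : G -> C) (A : set G) : Prop :=
  exists k : C, forall a : G, A a -> c a = k.

(* Main.v *)
Require Import Defs.
From HB Require Import structures.
From mathcomp Require Import all_boot all_order all_algebra all_field.
From mathcomp Require Import boolp classical_sets functions cardinality.
Set Implicit Arguments.
Unset Strict Implicit.
Unset Printing Implicit Defensive.

(** G embeds into the group of finitely supported functions from G to the
countable group of nonzero algebraic numbers.  This group is divisible and has
elements of every order, so an embedding of a subgroup extends to one more
generator of prime or infinite order: either some p-th root of the image is not
yet in the range, or a new coordinate is used.

Colour x by the list of nontrivial coordinates of its image.  If X + X is
monochromatic, supports of elements of X have bounded size and each coordinate
takes finitely many values on X.  Take R of maximal size such that infinitely
many elements of X agree and are nontrivial on R; two of these, x <> y, have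
disjoint supports outside R.  Since supp (x + y) is as large as supp (x + x) and
as supp (y + y), both supports lie inside R, whence x = y. *)

Import GRing.Theory Num.Theory.
Local Open Scope classical_set_scope.
Local Open Scope card_scope.

(** * Extending partial embeddings, and Zorn's lemma *)

Section Embedding.
Local Open Scope ring_scope.
Variable G : zmodType.
Implicit Types (A : set (G * (G -> algC))) (g h i : G) (f e d : G -> algC).

(* [A] is the graph of an embedding of a subgroup, written multiplicatively on
   the right; [A = set0] is also allowed, so that empty chains have a union.
   New elements of the domain serve as their own coordinates, whence [pe_supp]. *)
Record partial_embedding A : Prop := PartialEmbedding {
  pe_comb : forall (k : int) g f h e, A (g, f) -> A (h, e) ->
    A (g + h *~ k, fun i => f i * e i ^ k);
  pe_neq0 : forall g f i, A (g, f) -> f i != 0;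
  pe_finite : forall g f, A (g, f) -> finite_set [set i | f i != 1];
  pe_supp : forall g f i, A (g, f) -> f i != 1 -> exists e, A (i, e);
  pe_inj : forall g f, A (g, f) -> (g = 0 <-> f = fun=> 1) }.

Lemma partial_embedding_bigcup (F : set (set (G * (G -> algC)))) :
    F `<=` partial_embedding -> total_on F subset ->
  partial_embedding (\bigcup_(A in F) A).
Proof.
move=> peF totF; split.
- move=> k g f h e [A FA Ag] [B FB Bh].
  have [/(_ _ Ag) Bg|/(_ _ Bh) Ah] := totF _ _ FA FB.
    by exists B => //; apply: (pe_comb (peF _ FB)).
  by exists A => //; apply: (pe_comb (peF _ FA)).
- by move=> g f i [A /peF peA Ag]; apply: (pe_neq0 peA) Ag.
- by move=> g f [A /peF peA Ag]; apply: (pe_finite peA) Ag.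
- move=> g f i [A FA Ag] fi; have [e Ae] := pe_supp (peF _ FA) Ag fi.
  by exists e, A.
- by move=> g f [A /peF peA Ag]; apply: (pe_inj peA) Ag.
Qed.

Lemma partial_embedding_trivial : partial_embedding [set (0, fun=> 1)].
Proof.
split=> [k g f h e|g f i|g f|g f i|g f].
- by move=> [-> ->] [-> ->]; rewrite mul0rz addr0 exp1rz mulr1.
- by move=> [_ ->]; rewrite oner_eq0.
- by move=> [_ ->]; apply: (sub_finite_set (B := set0)) => // i /=; rewrite eqxx.
- by move=> [_ ->]; rewrite eqxx.
- by move=> [-> ->].
Qed.

Lemma partial_embedding_adjoin A g d :
    partial_embedding A -> A (0, fun=> 1) -> (forall i, d i != 0) ->
    finite_set [set i | d i != 1] ->
    (forall i, d i != 1 -> i = g \/ exists e, A (i, e)) ->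
    (forall h f (k : int), A (h, f) ->
       (h + g *~ k = 0 <-> (fun i => f i * d i ^ k) = fun=> 1)) ->
  partial_embedding
    [set p | exists h f (k : int),
       A (h, f) /\ p = (h + g *~ k, fun i => f i * d i ^ k)].
Proof.
move=> peA A1 d0 dfin dsupp dinj; split.
- move=> k _ _ _ _ [h1 [f1 [k1 [A1' [-> ->]]]]] [h2 [f2 [k2 [A2' [-> ->]]]]].
  exists (h1 + h2 *~ k), (fun i => f1 i * f2 i ^ k), (k1 + k2 * k).
  split; first exact: (pe_comb peA).
  rewrite mulrzDl mulrzDr mulrzA addrACA; congr (_, _).
  by apply/funext => i; rewrite expfzMl exprz_exp expfzDr// mulrACA.
- move=> _ _ i [h [f [k [Ah [_ ->]]]]].
  by rewrite mulf_neq0 ?expfz_neq0// (pe_neq0 peA _ Ah).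
- move=> _ _ [h [f [k [Ah [_ ->]]]]].
  apply: (sub_finite_set (B := [set i | f i != 1] `|` [set i | d i != 1])).
    move=> i /=; have [->|? _] := eqVneq (f i) 1; last by left.
    by have [->|? _] := eqVneq (d i) 1; [rewrite exp1rz mulr1 eqxx | right].
  by rewrite finite_setU; split=> //; apply: (pe_finite peA) Ah.
- move=> _ _ i [h [f [k [Ah [_ ->]]]]] fdi.
  have inA e : A (i, e) -> exists e0 h0 f0 (k0 : int),
      A (h0, f0) /\ (i, e0) = (h0 + g *~ k0, fun j => f0 j * d j ^ k0).
    move=> Ai; exists e, i, e, 0; split=> //; rewrite mulr0z addr0.
    by congr (_, _); apply/funext => j; rewrite expr0z mulr1.
  have [f1|fi] := eqVneq (f i) 1; last first.
    by have [e /inA] := pe_supp peA Ah fi.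
  have [di|di] := eqVneq (d i) 1; first by rewrite f1 di exp1rz mulr1 eqxx in fdi.
  have [->|[e /inA//]] := dsupp _ di.
  by exists (fun j => 1 * d j ^ 1), 0, (fun=> 1), 1; split=> //; rewrite add0r mulr1z.
- by move=> _ _ [h [f [k [Ah [-> ->]]]]]; apply: dinj.
Qed.

(** * Maximal partial embeddings are total *)

Section Maximal.
Variable A : set (G * (G -> algC)).
Hypothesis peA : partial_embedding A.
Hypothesis maxA : forall B, A `<` B -> ~ partial_embedding B.

Lemma maximal_pe0 : A (0, fun=> 1).
Proof.
have [[[g f] Ag]|nA] := pselect (exists p, A p).
  have := pe_comb peA (-1) Ag Ag; rewrite mulrN1z subrr.
  congr (A (_, _)); apply/funext => i.
  by rewrite exprN1 ?mulfV// (pe_neq0 peA _ Ag).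
(* The empty graph is not maximal: the trivial one properly contains it. *)
exfalso; apply: maxA partial_embedding_trivial; split.
  by move=> p Ap; case: nA; exists p.
by move=> /(_ (0, fun=> 1) erefl) A0; apply: nA; exists (0, fun=> 1).
Qed.

Lemma maximal_peZ (k : int) h e :
  A (h, e) -> A (h *~ k, fun i => e i ^ k).
Proof.
move=> /(pe_comb peA k maximal_pe0); rewrite add0r; congr (A (_, _)).
by apply/funext => i; rewrite mul1r.
Qed.

Lemma maximal_peD g f h e : A (g, f) -> A (h, e) ->
  A (g + h, fun i => f i * e i).
Proof. exact: (pe_comb peA 1). Qed.

(** Take the quotient of the two pairs: one direction of [pe_inj] makes the graph single-valued, and
    the other makes it injective in [pe_fun_inj]. *)
Lemma pe_fun g f e : A (g, f) -> A (g, e) -> f = e.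
Proof.
move=> Af Ae; have := pe_comb peA (-1) Af Ae; rewrite mulrN1z subrr.
move=> /(pe_inj peA)[/(_ erefl) fe _]; apply/funext => i.
move: (congr1 (@^~ i) fe) => /=; rewrite exprN1 => /divr1_eq; exact.
Qed.

Lemma pe_fun_inj g h f : A (g, f) -> A (h, f) -> g = h.
Proof.
move=> Ag Ah; have := pe_comb peA (-1) Ag Ah; rewrite mulrN1z.
move=> /(pe_inj peA)[_ gh]; apply/eqP; rewrite -subr_eq0; apply/eqP/gh.
by apply/funext => i; rewrite exprN1 mulfV// (pe_neq0 peA _ Ag).
Qed.

Lemma maximal_pe_adjoin g d :
    (forall i, d i != 0) -> finite_set [set i | d i != 1] ->
    (forall i, d i != 1 -> i = g \/ exists e, A (i, e)) ->
    (forall h f (k : int), A (h, f) ->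
       (h + g *~ k = 0 <-> (fun i => f i * d i ^ k) = fun=> 1)) ->
  A (g, d).
Proof.
move=> d0 dfin dsupp dinj; apply: contrapT => nAg.
have := partial_embedding_adjoin peA maximal_pe0 d0 dfin dsupp dinj.
apply: maxA; split.
  move=> [h f] Ah; exists h, f, 0; split=> //; rewrite mulr0z addr0.
  by congr (_, _); apply/funext => i; rewrite expr0z mulr1.
move=> /(_ (g, d)) sBA; apply: nAg; apply: sBA.
exists 0, (fun=> 1), 1; split; first exact: maximal_pe0.
by rewrite add0r; congr (_, _); apply/funext => i; rewrite mul1r.
Qed.

(** Supplies the side conditions of [maximal_pe_adjoin] when [d] is an old image altered only at the
    new coordinate [g]. *)
Lemma maximal_pe_fresh g d (f1 : G -> algC) h :
    A (h, f1) -> (forall i, i != g -> d i = f1 i) -> d g != 0 ->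
  [/\ forall i, d i != 0, finite_set [set i | d i != 1] &
      forall i, d i != 1 -> i = g \/ exists e, A (i, e)].
Proof.
move=> Ah df dg; split.
- by move=> i; have [->|/df->] := eqVneq i g; rewrite ?dg//; apply: (pe_neq0 peA) Ah.
- apply: (sub_finite_set (B := [set g] `|` [set i | f1 i != 1])).
    by move=> i /=; have [->|/df->] := eqVneq i g; [left | right].
  by rewrite finite_setU; split=> //; apply: (pe_finite peA) Ah.
- move=> i; have [->|/df->] := eqVneq i g; first by left.
  by move=> /(pe_supp peA Ah); right.
Qed.

(* The subgroup generated by the domain of [A] and [g] meets that domain in the
   same multiples of [g] as the range of [A] does in powers of [d], by Bezout. *)
Lemma maximal_pe_prime (p : nat) g d f0 :
    prime p -> A (g *~ p, f0) -> (forall i, d i ^+ p = f0 i) ->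
    (forall h, ~ A (h, d)) -> finite_set [set i | d i != 1] ->
    (forall i, d i != 1 -> i = g \/ exists e, A (i, e)) ->
  exists e, A (g, e).
Proof.
move=> pp Apg dp nAd dfin dsupp; apply: contrapT => nAg.
have d0 i : d i != 0.
  have := pe_neq0 peA i Apg; rewrite -dp; apply: contra_neq => ->.
  by rewrite expr0n gtn_eqF ?prime_gt0.
apply: (nAg); exists d; apply: maximal_pe_adjoin => // h f k Ah.
have [/dvdzP[m ->]|npk] := boolP (p %| k)%Z.
  have -> : g *~ (m * p) = g *~ p *~ m by rewrite mulrC mulrzA.
  have -> : (fun i => f i * d i ^ (m * p)) = (fun i => f i * f0 i ^ m).
    by apply/funext => i; rewrite mulrC -dp exprnP exprz_exp [_ * m]mulrC mulrC.
  exact: (pe_inj peA (pe_comb peA m Ah Apg)).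
(* With u p + v k = 1, the relation h + k g = 0 puts g = u (p g) - v h in the domain, and f d^k = 1
   puts d = f0^u f^(-v) in the range. Both are excluded, so neither relation holds. *)
have /coprimezP[[u v] /= uv] : coprimez p k by rewrite coprimezE /= prime_coprime.
split=> [hk|fk].
  case: nAg; exists (fun i => f0 i ^ u * f i ^ (- v)).
  suff <- : g *~ p *~ u + h *~ (- v) = g by apply: (pe_comb peA) Ah; apply: maximal_peZ.
  have -> : h = - (g *~ k) by apply/eqP; rewrite -addr_eq0 hk.
  by rewrite mulNrz mulrNz opprK -!mulrzA -mulrzDr mulrC [k * v]mulrC uv mulr1z.
case: (nAd (g *~ p *~ u + h *~ (- v))).
suff -> : d = (fun i => f0 i ^ u * f i ^ (- v)).
  by apply: (pe_comb peA) Ah; apply: maximal_peZ.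
apply/funext => i.
have fi : f i = (d i ^ k)^-1.
  by rewrite -[f i]invrK; congr _^-1; apply: mulr1_eq; apply: (congr1 (@^~ i) fk).
rewrite fi -dp exprnP exprz_exp invr_expz exprz_exp -expfzDr//.
by rewrite mulNr mulrN opprK mulrC [k * v]mulrC uv.
Qed.

Lemma maximal_pe_divisible_prime (p : nat) g :
  prime p -> (exists f, A (g *~ p, f)) -> exists e, A (g, e).
Proof.
move=> pp [f0 Apg]; apply: contrapT => nAg; have p0 := prime_gt0 pp.
have [[h [f1 [Ah hp]]]|nh] := pselect (exists h f1, A (h, f1) /\ h *~ p = g *~ p).
  have [z pz] := C_prim_root_exists p0.
  have f1g : f1 g = 1 by apply: contrapT => /eqP /(pe_supp peA Ah).
  pose d i := if i == g then z else f1 i.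
  have dg : d g = z by rewrite /d eqxx.
  have df i : i != g -> d i = f1 i by rewrite /d => /negbTE->.
  have z0 : z != 0 by rewrite (prim_root_eq0 pz) gtn_eqF.
  have z1 : z != 1.
    rewrite -[z]expr1 -(prim_order_dvd pz) dvdn1.
    by apply: contraTneq pp => ->.
  have [|_ dfin dsupp] := maximal_pe_fresh Ah df; first by rewrite dg.
  apply: (nAg); apply: (maximal_pe_prime pp Apg _ _ dfin dsupp).
    have := maximal_peZ p Ah; rewrite hp => /(pe_fun Apg) -> i.
    have [->|/df->//] := eqVneq i g; by rewrite dg f1g prim_expr_order ?exp1rz.
  by move=> x Ad; apply: nAg; apply: (pe_supp peA Ad); rewrite dg.
pose d i := p.-root (f0 i).
(* The chosen root of 1 is 1, so taking roots keeps the support finite. *)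
have d1 i : (d i != 1) = (f0 i != 1) by rewrite /d rootC_eq1.
apply: nAg; apply: (@maximal_pe_prime p g d f0) => //.
- by move=> i; rewrite rootCK.
- move=> h Ah; apply: nh; exists h, d; split=> //.
  apply: (@pe_fun_inj _ _ f0) Apg; have := maximal_peZ p Ah.
  by congr (A (_, _)); apply/funext => i; rewrite -exprnP rootCK.
- by apply: sub_finite_set (pe_finite peA Apg) => i /=; rewrite d1.
- by move=> i; rewrite d1 => /(pe_supp peA Apg); right.
Qed.

Lemma maximal_pe_divisible (n : nat) g :
  (0 < n)%N -> (exists f, A (g *~ n, f)) -> exists e, A (g, e).
Proof.
elim/ltn_ind: n g => n IH g n0; have [n1|n1] := leqP n 1.
  by have -> : n = 1%N by apply/eqP; rewrite eqn_leq n1.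
have [p pp /dvdnP[m nE]] := pdivP n1.
have m0 : (0 < m)%N by move: n0; rewrite nE muln_gt0 => /andP[].
rewrite nE PoszM mulrzA => /(maximal_pe_divisible_prime pp); apply: IH => //.
by rewrite nE ltn_Pmulr ?prime_gt1.
Qed.

Lemma maximal_pe_total g : exists f, A (g, f).
Proof.
apply: contrapT => nAg.
have indep (k : int) : k != 0 -> ~ exists f, A (g *~ k, f).
  case: k => n n0 Ak; apply: nAg; first by apply: maximal_pe_divisible Ak; rewrite lt0n.
  apply: (@maximal_pe_divisible n.+1) => //; case: Ak => f /(maximal_peZ (-1)).
  by rewrite NegzE mulrN1z mulrNz opprK; exists (fun i => f i ^ (-1)).
(* By [indep], [g] needs an image of infinite order modulo the range. The coordinate [g] is trivial
   on the range, and 2 is not a root of unity. *)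
pose d i : algC := if i == g then 2 else 1.
have dg : d g = 2 by rewrite /d eqxx.
have [||d0 dfin dsupp] := @maximal_pe_fresh g d (fun=> 1) 0 maximal_pe0.
- by move=> i /negbTE; rewrite /d => ->.
- by rewrite dg pnatr_eq0.
apply: nAg; exists d; apply: maximal_pe_adjoin => // h f k Ah.
have [->|k0] := eqVneq k 0.
  rewrite mulr0z addr0; have -> : (fun i => f i * d i ^ 0) = f.
    by apply/funext => i; rewrite expr0z mulr1.
  exact: (pe_inj peA) Ah.
split=> [hk|fk]; exfalso.
  apply: (indep k k0); exists (fun i => f i ^ (-1)).
  have -> : g *~ k = h *~ (-1) by apply/eqP; rewrite mulrN1z -addr_eq0 addrC hk.
  exact: maximal_peZ.
have fg : f g = 1.
  apply: contrapT => /eqP /(pe_supp peA Ah)[e Ag].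
  by apply: (indep 1) => //; exists e.
move: (congr1 (@^~ g) fk) => /eqP /=; rewrite fg dg mul1r pexprz_eq1 ?ler0n//.
by rewrite (negbTE k0) (eqr_nat _ 2 1).
Qed.

End Maximal.

Lemma embedding_exists : exists phi : G -> G -> algC,
  [/\ injective phi, forall x y i, phi (x + y) i = phi x i * phi y i,
      forall x i, phi x i != 0 & forall x, finite_set [set i | phi x i != 1]].
Proof.
have [A [peA maxA]] := Zorn_bigcup partial_embedding_bigcup.
have [phi Aphi] := choice (maximal_pe_total peA maxA).
exists phi; split.
- by move=> x y xy; apply: (pe_fun_inj peA (Aphi x)); rewrite xy; apply: Aphi.
- move=> x y i; have := maximal_peD peA (Aphi x) (Aphi y).
  by move=> /(pe_fun peA (Aphi (x + y))) ->.
- by move=> x i; apply: (pe_neq0 peA) (Aphi x).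
- by move=> x; apply: (pe_finite peA) (Aphi x).
Qed.

End Embedding.

(** * The sunflower argument *)

Section Sunflower.
Local Open Scope ring_scope.
Variables (G : zmodType) (I : eqType) (K : fieldType) (phi : G -> I -> K).
Variable supp : G -> seq I.
Hypothesis phi_inj : injective phi.
Hypothesis phiD : forall x y i, phi (x + y) i = phi x i * phi y i.
Hypothesis phi_neq0 : forall x i, phi x i != 0.
Hypothesis supp_uniq : forall x, uniq (supp x).
Hypothesis mem_supp : forall x i, (i \in supp x) = (phi x i != 1).

(* The support of [x + y] is that of [x + x] inside [R], and the disjoint union
   of those of [x] and [y] outside [R]; the support of [x + x] can only shrink
   outside [R]. *)
Lemma sunflower_petal_trivial (R : seq I) x y :
    {in R, phi x =1 phi y} ->
    (forall i, i \notin R -> phi x i = 1 \/ phi y i = 1) ->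
    size (supp (x + y)) = size (supp (x + x)) ->
  forall i, i \notin R -> phi y i = 1.
Proof.
move=> agree disj sz i iR; apply: contrapT => /eqP yi.
pose out := [pred j | j \notin R].
pose u := filter (predC out) (supp (x + x)) ++
          (filter out (supp x) ++ filter out (supp y)).
have uu : uniq u.
  rewrite !cat_uniq !filter_uniq ?supp_uniq//= andbT.
  apply/andP; split; apply/hasPn => j; rewrite ?mem_cat !mem_filter /= ?mem_supp.
    by case/orP => /andP[-> _].
  by move=> /andP[jR yj]; rewrite jR; case: (disj j jR) yj => ->; rewrite eqxx.
have sub_u : {subset u <= supp (x + y)}.
  move=> j; rewrite !mem_cat !mem_filter /= !mem_supp !phiD negbK.
  case/or3P => /andP[jR]; first by rewrite (agree _ jR).
    by case: (disj _ jR) => ->; rewrite ?mulr1// eqxx.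
  by case: (disj _ jR) => ->; rewrite ?mul1r// eqxx.
(* Cancelling the part inside [R] leaves out(x) + out(y) <= out(x + x) <= out(x), where out counts
   support outside [R]; so out(y) = 0. *)
have := uniq_leq_size uu sub_u; rewrite sz !size_cat !size_filter.
rewrite -(count_predC out (supp (x + x))) addnC leq_add2r.
have : (count out (supp (x + x)) <= count out (supp x))%N.
  rewrite -!size_filter; apply: uniq_leq_size; first by rewrite filter_uniq.
  move=> j; rewrite !mem_filter !mem_supp phiD => /andP[-> /=].
  by apply: contra_neq => ->; rewrite mulr1.
move=> /[swap] /leq_trans/[apply]; rewrite -{2}[count _ (supp x)]addn0 leq_add2l leqn0.
by apply/negP; rewrite -lt0n -has_count; apply/hasP; exists i; rewrite ?mem_supp.
Qed.

Variables (X : set G) (l : seq K).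
Hypothesis X_inf : infinite_set X.
Hypothesis colourX : forall x y, X x -> X y -> map (phi (x + y)) (supp (x + y)) = l.

Lemma colour_size x y : X x -> X y -> size (supp (x + y)) = size l.
Proof. by move=> Xx Xy; rewrite -(colourX Xx Xy) size_map. Qed.

Lemma colour_value x y i : X x -> X y -> phi (x + y) i \in 1 :: l.
Proof.
move=> Xx Xy; rewrite inE; have [//|xyi] := eqVneq (phi (x + y) i) 1.
by rewrite -(colourX Xx Xy) map_f// mem_supp.
Qed.

(** Outside the support of [x0], the elements [x] and [x + x0] have the same coordinates. *)
Lemma supp_bounded x0 x : X x0 -> X x ->
  (size (supp x) <= size l + size (supp x0))%N.
Proof.
move=> X0 Xx; rewrite -(colour_size Xx X0) -size_cat.
apply: uniq_leq_size => // i; rewrite mem_cat !mem_supp phiD.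
by have [->|_] := eqVneq (phi x0 i) 1; rewrite ?orbT// mulr1 orbF.
Qed.

(** A candidate sunflower kernel: disjointness of the petals is not demanded here, but obtained
    later from the maximality of [R]. *)
Definition kernel_of (R : seq I) (Y : set G) :=
  [/\ infinite_set Y, Y `<=` X, uniq R,
      forall y, Y y -> {subset R <= supp y} &
      forall x y, Y x -> Y y -> {in R, phi x =1 phi y}].

(** Pigeonhole: for a fixed [x0], the value of y at [i] is that of y + x0, one of finitely many,
    divided by that of [x0]. *)
Lemma kernel_extend R Y i : kernel_of R Y -> i \notin R ->
    infinite_set [set y | Y y /\ phi y i != 1] ->
  exists Z, kernel_of (i :: R) Z.
Proof.
move=> [Yinf YX uR Rsupp agree] iR Zinf.
have [x0 Yx0] := infinite_setN0 Yinf.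
have [v vinf] : exists v, infinite_set [set y | [/\ Y y, phi y i != 1 & phi y i = v]].
  apply: contrapT => nv; apply: Zinf.
  pose V := [set` [seq w / phi x0 i | w <- 1 :: l]].
  apply: (sub_finite_set (B := \bigcup_(v in V)
      [set y | [/\ Y y, phi y i != 1 & phi y i = v]])).
    move=> y [Yy yi]; exists (phi y i) => //; apply/mapP.
    exists (phi (y + x0) i); first by apply: colour_value; apply: YX.
    by rewrite phiD mulfK.
  apply: bigcup_finite => [|v _]; first exact: finite_seq.
  by apply: contrapT => vinf; apply: nv; exists v.
exists [set y | [/\ Y y, phi y i != 1 & phi y i = v]]; split=> //.
- by move=> y [/YX].
- by rewrite /= iR.
- by move=> y [Yy yi _] j; rewrite inE => /orP[/eqP->|/(Rsupp _ Yy)//]; rewrite mem_supp.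
- move=> x y [Yx _ xi] [Yy _ yi] j; rewrite inE => /orP[/eqP->|]; first by rewrite xi.
  exact: agree.
Qed.

Lemma kernel_exists : exists R Y, kernel_of R Y /\
  forall i, i \notin R -> finite_set [set y | Y y /\ phi y i != 1].
Proof.
have [x0 X0] := infinite_setN0 X_inf.
pose P n := `[< exists R Y, kernel_of R Y /\ size R = n >].
have exP : exists n, P n.
  exists 0%N; apply/asboolP; exists [::], X; split=> //; split=> //.
have boundP n : P n -> (n <= size l + size (supp x0))%N.
  move=> /asboolP[R [Y [[Yinf YX uR Rsupp _] <-]]].
  have [y Yy] := infinite_setN0 Yinf.
  by apply: leq_trans (supp_bounded X0 (YX _ Yy)); apply/uniq_leq_size/Rsupp.
case: (ex_maxnP exP boundP) => n /asboolP[R [Y [kY szR]]] maxR.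
exists R, Y; split=> // i iR; apply: contrapT => Zinf.
have [Z kZ] := kernel_extend kY iR Zinf.
suff /maxR : P n.+1 by rewrite ltnn.
by apply/asboolP; exists (i :: R), Z; rewrite /= szR.
Qed.

Lemma no_monochromatic_sumset : False.
Proof.
have [R [Y [[Yinf YX uR Rsupp agree] fin]]] := kernel_exists.
have [x Yx] := infinite_setN0 Yinf.
(* The elements to avoid: [x] itself and those whose support meets that of [x] outside [R]. *)
pose B := [set x] `|` \bigcup_(i in [set` [seq i <- supp x | i \notin R]])
            [set y | Y y /\ phi y i != 1].
have Bfin : finite_set B.
  rewrite finite_setU; split=> //; apply: bigcup_finite; first exact: finite_seq.
  by move=> i /=; rewrite mem_filter => /andP[/fin].
have [y [Yy nBy]] := infinite_setN0 (infinite_setD Yinf Bfin).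
have disj i : i \notin R -> phi x i = 1 \/ phi y i = 1.
  move=> iR; apply: contrapT => /not_orP[/eqP xi /eqP yi]; apply: nBy.
  by right; exists i; rewrite /= ?mem_filter ?iR ?mem_supp.
(* Comparing with x + x empties the petal of [y], and comparing with y + y that of [x]. *)
have xy_out i : i \notin R -> phi x i = phi y i.
  move=> iR; rewrite (sunflower_petal_trivial (agree _ _ Yy Yx) _ _ iR); first last.
  - by rewrite !colour_size//; apply: YX.
  - by move=> j /disj[]; [right | left].
  rewrite (sunflower_petal_trivial (agree _ _ Yx Yy) disj _ iR)//.
  by rewrite !colour_size//; apply: YX.
apply: nBy; left; apply: phi_inj; apply/funext => i.
by have [iR|/xy_out] := boolP (i \in R); [apply: agree | ].
Qed.

End Sunflower.

Theorem theorem5 (G : zmodType) :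
  exists (C : Type) (c : G -> C),
    [set: C] #= [set: nat] /\
    forall X : set G, infinite_set X -> ~ monochromatic c (sumset X).
Proof.
have [phi [phi_inj phiD phi_neq0 phi_fin]] := embedding_exists G.
have /choice[supp suppP] (x : G) : exists s : seq G,
    uniq s /\ forall i, (i \in s) = (phi x i != 1%R).
  have /finite_seqP[s sE] := phi_fin x; exists (undup s); split.
    exact: undup_uniq.
  move=> i; rewrite mem_undup; apply/idP/idP => [is_|xi].
    by have : [set` s] i by []; rewrite -sE.
  by have : [set i | phi x i != 1%R] i by []; rewrite sE.
(* Only values are recorded, not their positions: [algC] is countable, while [G] need not be. *)
exists nat, (fun x => pickle (map (phi x) (supp x))).
split=> [|X Xinf [k Xk]]; first exact: card_eqxx.
have [x0 X0] := infinite_setN0 Xinf.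
apply: (@no_monochromatic_sumset _ _ _ phi supp phi_inj phiD phi_neq0 _ _ X
  (map (phi (x0 + x0)%R) (supp (x0 + x0)%R)) Xinf).
- by move=> x; have [] := suppP x.
- by move=> x; have [] := suppP x.
- move=> x y Xx Xy; apply: (pcan_inj pickleK).
  transitivity k; [|symmetry]; apply: Xk; last by exists x0 => //; exists x0.
  by exists x => //; exists y.
Qed.
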